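(* Let $k\ge 1$ and let $\{S_j(x)=\varrho x+d_j : j=0,\dots,k\}$, with $0<\varrho<1$, be an equicontractive iterated function system on $\mathbb{R}$ which satisfies the strong separation condition and is of finite type on the torus $\mathbb{T}$. Assume $0=d_0<d_1<\cdots<d_k$ and that $\delta=(1-\varrho)^{-1}d_k$ is an integer. Let $\{p_j\}_{j=0}^k$ be probabilities ($p_j>0$, $\sum_j p_j=1$), let $\mu$ be the associated self-similar measure with self-similar set (support) $K$, and let $\mu_\pi$ be its quotient measure on $\mathbb{T}$. Then $$\{\dim_{loc}\mu(x):x\in K\}=\left[\frac{\log(\max_i p_i)}{\log\varrho},\frac{\log(\min_i p_i)}{\log\varrho}\right]=\{\dim_{loc}\mu_\pi(x):x\in\pi(K)\}.$$
   Context: The self-similar set $K\subseteq\mathbb{R}$ is the unique non-empty compact set with $K=\bigcup_{j=0}^k S_j(K)$; its convex hull here is $[0,\delta]$. The self-similar measure $\mu$ is the unique probability measure with $\mu=\sum_{j=0}^k p_j\,\mu\circ S_j^{-1}$; its support is $K$. The IFS satisfies the strong separation condition if the sets $S_j(K)$, $j=0,\dots,k$, are pairwise disjoint. $\mathbb{T}$ is the torus $\mathbb{R}/\mathbb{Z}$, $\pi:\mathbb{R}\to\mathbb{T}$ is the canonical quotient map, and $d_{\mathbb{T}}(\pi(x),\pi(y))=\min_{m\in\mathbb{Z}}|x-y+m|$. The quotient measure is $\mu_\pi(E)=\mu(\pi^{-1}(E))$ for Borel $E\subseteq\mathbb{T}$. With $\mathcal{A}=\{0,\dots,k\}$ and $\sigma=(\sigma_1,\dots,\sigma_n)\in\mathcal{A}^n$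 put $S_\sigma=S_{\sigma_1}\circ\cdots\circ S_{\sigma_n}$. The IFS is of finite type on the torus $\mathbb{T}$ if there is a finite set $F\subseteq\mathbb{R}$ such that for every positive integer $n$ and all $\sigma,\tau\in\mathcal{A}^n$, either $d_{\mathbb{T}}(\pi(S_\sigma(0)),\pi(S_\tau(0)))>\varrho^n\delta$ or $d_{\mathbb{T}}(\pi(S_\sigma(0)),\pi(S_\tau(0)))\in\varrho^nF$. The local dimension of a probability measure $\nu$ on a metric space at a point $x$ of its support is $\dim_{loc}\nu(x)=\lim_{r\to0}\frac{\log\nu(B(x,r))}{\log r}$. A set of local dimensions $\{\dim_{loc}\nu(x):x\in X\}$ is the set of values of this limit over the points $x\in X$ at which it exists. *)

(* Defs.v *)
From HB Require Import structures.
From mathcomp Require Import all_boot all_order all_algebra.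
From mathcomp Require Import generic_quotient archimedean lra.
From mathcomp Require Import all_classical all_reals all_analysis.
From mathcomp Require Import measurable_realfun.

Set Implicit Arguments.
Unset Strict Implicit.
Unset Printing Implicit Defensive.

Import Order.TTheory GRing.Theory Num.Theory.
Import numFieldNormedType.Exports.

Local Open Scope classical_set_scope.
Local Open Scope ring_scope.

Section torus_def.
Variable R : realType.

Definition eqmodZ : rel R := fun x y => x - y \is a Num.int.

Lemma eqmodZ_equiv : equiv_class_of eqmodZ.
Proof.
split.
- by move=> x; rewrite /eqmodZ subrr.
- by move=> x y; rewrite /eqmodZ -(rpredN _ (x - y)) opprB.
- move=> y x z; rewrite /eqmodZ => xy yz.
  have -> : x - z = (x - y) + (y - z) by lra.
  exact: rpredD.
Qed.

Canonical eqmodZ_rel := EquivRelPack eqmodZ_equiv.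

Definition torus := {eq_quot eqmodZ_rel}%qT.

HB.instance Definition _ := Choice.on torus.
HB.instance Definition _ := EqQuotient.on torus.
HB.instance Definition _ := isPointed.Build torus (\pi_torus 0)%qT.

Definition torus_pi (x : R) : torus := (\pi_torus x)%qT.

Lemma torus_pi_eq x y : torus_pi x = torus_pi y <-> x - y \is a Num.int.
Proof.
split; first by move/eqP; rewrite /torus_pi eqquotE.
by move=> xy; apply/eqP; rewrite /torus_pi eqquotE.
Qed.

Lemma torus_pi_repr (u : torus) : torus_pi (repr u) = u.
Proof. exact: reprK. Qed.

Definition lift_dists (x y : R) : set R :=
  [set `|x - y + m%:~R| | m in [set: int]].

Definition torus_dist (u v : torus) : R := inf (lift_dists (repr u) (repr v)).

Lemma lift_dists_min x y : exists2 m : int,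
  lift_dists x y `|x - y + m%:~R| & lbound (lift_dists x y) `|x - y + m%:~R|.
Proof.
pose a := x - y - (Num.floor (x - y))%:~R.
have a0 : 0 <= a by rewrite subr_ge0 floor_le_tmp.
have a1 : a < 1 by rewrite ltrBlDl -intrD1 floorD1_gt.
have low (m : int) : Num.min a (1 - a) <= `|a + m%:~R|.
  rewrite ge_min; case: (lerP 0 m) => m0.
    apply/orP; left; have : 0 <= m%:~R :> R by rewrite ler0z.
    by move=> mp; rewrite ger0_norm; lra.
  apply/orP; right; have : m%:~R <= (-1)%:~R :> R.
    by rewrite ler_int -ltzD1 addNr.
  by rewrite mulrN1z => mN; rewrite ler0_norm; lra.
have shift (m : int) :
    x - y + m%:~R = a + (m + Num.floor (x - y))%:~R.
  by rewrite intrD /a; lra.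
have [aa|aa] := leP a (1 - a).
  exists (- Num.floor (x - y)); first by exists (- Num.floor (x - y)).
  move=> _ [m _ <-]; rewrite intrN -/a ger0_norm//.
  by have := low (m + Num.floor (x - y)); rewrite (min_l aa) -shift.
exists (- (Num.floor (x - y) + 1)).
  by exists (- (Num.floor (x - y) + 1)).
move=> _ [m _ <-].
have -> : `|x - y + (- (Num.floor (x - y) + 1))%:~R| = 1 - a.
  by rewrite intrN intrD opprD addrA -/a ler0_norm; lra.
by have := low (m + Num.floor (x - y)); rewrite (min_r (ltW aa)) -shift.
Qed.

Lemma lift_dists_sub x y x' y' : x - x' \is a Num.int -> y - y' \is a Num.int ->
  lift_dists x y `<=` lift_dists x' y'.
Proof.
move=> /intrP[a xa] /intrP[b yb] _ [m _ <-]; exists (m + a - b) => //.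
by rewrite intrB intrD -xa -yb; congr `|_|; lra.
Qed.

Lemma torus_distE x y :
  torus_dist (torus_pi x) (torus_pi y) = inf (lift_dists x y).
Proof.
have hx : repr (torus_pi x) - x \is a Num.int.
  by apply/torus_pi_eq; rewrite torus_pi_repr.
have hy : repr (torus_pi y) - y \is a Num.int.
  by apply/torus_pi_eq; rewrite torus_pi_repr.
congr inf; apply/seteqP; split; apply: lift_dists_sub => //.
  by rewrite -opprB rpredN.
by rewrite -opprB rpredN.
Qed.

(* The infimum in torus_dist is a minimum. *)
Lemma torus_distP x y :
  (exists m : int, torus_dist (torus_pi x) (torus_pi y) = `|x - y + m%:~R|) /\
  (forall m : int, torus_dist (torus_pi x) (torus_pi y) <= `|x - y + m%:~R|).
Proof.
have [m im lm] := lift_dists_min x y.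
have hb : has_lbound (lift_dists x y) by exists `|x - y + m%:~R|.
have E : torus_dist (torus_pi x) (torus_pi y) = `|x - y + m%:~R|.
  rewrite torus_distE; apply/eqP; rewrite eq_le; apply/andP; split.
    exact: ge_inf.
  by apply: lb_le_inf => //; exists `|x - y + m%:~R|.
split; first by exists m.
by move=> n; rewrite E; apply: lm; exists n.
Qed.

Let distxx u : torus_dist u u = 0.
Proof.
rewrite -(torus_pi_repr u).
have [[m E] /(_ 0)] := torus_distP (repr u) (repr u).
rewrite subrr addr0 normr0 => le0; apply/eqP.
by rewrite eq_le le0 E normr_ge0.
Qed.

Let dist_pos u v : torus_dist u v = 0 -> u = v.
Proof.
rewrite -(torus_pi_repr u) -(torus_pi_repr v).
have [[m ->] _] := torus_distP (repr u) (repr v).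
move/normr0_eq0 => uv; apply/torus_pi_eq.
have -> : repr u - repr v = - m%:~R by lra.
by rewrite rpredN intr_int.
Qed.

Let dist_symle u v : torus_dist u v <= torus_dist v u.
Proof.
rewrite -(torus_pi_repr u) -(torus_pi_repr v).
have [[m ->] _] := torus_distP (repr v) (repr u).
have [_ /(_ (- m))] := torus_distP (repr u) (repr v).
move/le_trans; apply; rewrite -normrN le_eqVlt; apply/orP; left.
by apply/eqP; congr `|_|; rewrite intrN; lra.
Qed.

Let dist_sym u v : torus_dist u v = torus_dist v u.
Proof. by apply/eqP; rewrite eq_le !dist_symle. Qed.

Let dist_tri v u w : torus_dist u w <= torus_dist u v + torus_dist v w.
Proof.
rewrite -(torus_pi_repr u) -(torus_pi_repr v) -(torus_pi_repr w).
have [[m ->] _] := torus_distP (repr u) (repr v).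
have [[n ->] _] := torus_distP (repr v) (repr w).
have [_ /(_ (m + n))/le_trans] := torus_distP (repr u) (repr w); apply.
apply: le_trans (ler_normD _ _); rewrite intrD le_eqVlt; apply/orP; left.
by apply/eqP; congr `|_|; lra.
Qed.

HB.instance Definition _ :=
  isMetric.Build R torus distxx dist_pos dist_sym dist_tri.

HB.instance Definition _ := @isMeasurable.Build (sigma_display (@open torus))
  torus <<s @open torus >>
  (@sigma_algebra0 _ setT _) (@sigma_algebraC _ _)
  (@sigma_algebra_bigcup _ setT _).

Lemma torus_pi_continuous : continuous torus_pi.
Proof.
move=> x; apply/cvg_ballP => e e0; near=> y.
rewrite ballEmdist /= /mdist/=.
have [_ /(_ 0)/le_lt_trans] := torus_distP x y; apply; rewrite addr0.
by near: y; apply: (@cvgr_dist_lt _ _ _ _ _ id) => //; exact: cvg_id.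
Unshelve. all: by end_near. Qed.

Lemma torus_pi_measurable : measurable_fun [set: R] torus_pi.
Proof.
apply: (@measurability _ _ _ _ _ _ (@open torus)) => //.
move=> _ [U oU <-]; rewrite setTI; apply: open_measurable.
by apply: open_comp => // x _; exact: torus_pi_continuous.
Qed.

HB.instance Definition _ :=
  isMeasurableFun.Build _ _ R torus torus_pi torus_pi_measurable.

End torus_def.

Section ifs.
Variables (R : realType) (k : nat) (rho : R) (d : 'I_k.+1 -> R).

Definition ifs_map (j : 'I_k.+1) (x : R) : R := rho * x + d j.

(* foldr applies the last letter first: S_(s_1) \o ... \o S_(s_n). *)
Definition ifs_word (s : seq 'I_k.+1) (x : R) : R := foldr ifs_map x s.

Definition delta : R := (1 - rho)^-1 * d ord_max.

Definition self_similar_set (K : set R) : Prop :=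
  [/\ K !=set0, compact K & K = \bigcup_(j in [set: 'I_k.+1]) (ifs_map j @` K)].

Definition strong_separation (K : set R) : Prop :=
  trivIset [set: 'I_k.+1] (fun j => ifs_map j @` K).

Definition self_similar_measure (p : 'I_k.+1 -> R) (mu : probability R R) :=
  forall A : set R, measurable A ->
    (mu A = \sum_(j < k.+1) (p j)%:E * mu (ifs_map j @^-1` A))%E.

Definition finite_type_torus : Prop :=
  exists2 F : set R, finite_set F &
    forall n : nat, (0 < n)%N -> forall s t : n.-tuple 'I_k.+1,
      let D := mdist (torus_pi (ifs_word s 0)) (torus_pi (ifs_word t 0)) in
      rho ^+ n * delta < D \/ exists2 f : R, F f & D = rho ^+ n * f.

End ifs.

Section local_dimension.
Variables (R : realType) (T : pseudoMetricType R) (nu : set T -> \bar R).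
Local Open Scope ereal_scope.

(* As lne 0 = -oo and ln r < 0 near 0, points outside the support get +oo. *)
Definition has_locdim (x : T) (l : \bar R) : Prop :=
  lne (nu (ball x r)) / (ln r)%:E @[r --> (0:R)^'+] --> l.

Definition locdims (X : set T) : set (\bar R) :=
  [set l | exists2 x, X x & has_locdim x l].

End local_dimension.

(* Main.v *)
(* Write W s K for the piece of K coded by a word s, and P s for the product of
   its weights. By strong separation, a ball of radius comparable to
   rho ^ (size s) about a point of W s K has mu-measure comparable to P s. Hence
   every local dimension lies in [a, b], also on the torus, where a ball lifts to
   boundedly many balls. A greedily chosen code for which P s is comparable to
   rho ^ (t * size s) gives a point of local dimension t.

   On the torus, a translate x - m in K could carry more mass than x. Finite type
   yields a word sg such that every W sg K - m is disjoint from K or is again a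
   piece of K of the level of sg; at points of W sg K the translates then only
   change measures of balls by constants. To find sg, let W sg K be contained in
   K + m. Some piece of K + m lies inside W sg K: otherwise, since only finitely
   many relative positions occur, a fixed proportion of the pieces of K + m
   meeting W sg K is lost every L levels, and the remaining ones are too few to
   cover W sg K. *)
Require Import Defs.
From mathcomp Require Import all_boot all_order all_algebra.
From mathcomp Require Import archimedean.
From mathcomp Require Import all_classical all_reals all_analysis.
From mathcomp Require Import measurable_realfun ring lra zify.
Import Order.TTheory GRing.Theory Num.Theory.
Import numFieldNormedType.Exports.
Set Implicit Arguments.
Unset Strict Implicit.
Unset Printing Implicit Defensive.
Local Open Scope classical_set_scope.
Local Open Scope ring_scope.

(** * The attractor: coding by words, convex hull, separation *)

Section attractor.
Variables (R : realType) (k : nat) (rho : R) (d : 'I_k.+1 -> R) (K : set R).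
Hypothesis hrho : 0 < rho < 1.
Hypothesis hK : self_similar_set rho d K.
Local Notation S := (ifs_map rho d).
Local Notation W := (ifs_word rho d).

Let rho0 : 0 < rho. Proof. by case/andP: hrho. Qed.
Let rho1 : rho < 1. Proof. by case/andP: hrho. Qed.

Lemma ifs_wordE s x : W s x = rho ^+ size s * x + W s 0.
Proof.
elim: s => [|j s IH] /=; first by rewrite expr0 mul1r addr0.
rewrite /ifs_map IH exprS; ring.
Qed.

Lemma ifs_word_cat s t x : W (s ++ t) x = W s (W t x).
Proof. by rewrite /ifs_word foldr_cat. Qed.

Lemma ifs_wordB s x y : W s x - W s y = rho ^+ size s * (x - y).
Proof. by rewrite ifs_wordE [W s y]ifs_wordE; ring. Qed.

Lemma attractor_map j x : K x -> K (S j x).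
Proof.
by case: hK => _ _ E Kx; rewrite E; exists j => //; exists x.
Qed.

Lemma attractor_word s x : K x -> K (W s x).
Proof. by move=> Kx; elim: s => //= j s IH; exact: attractor_map. Qed.

Lemma attractor_wordP n x : K x ->
  exists s y, [/\ size s = n, K y & x = W s y].
Proof.
elim: n x => [|n IH] x Kx; first by exists [::], x.
have [_ _ E] := hK; have := Kx; rewrite {1}E => -[j _ [y Ky <-]].
have [s [z [sn Kz yE]]] := IH _ Ky.
by exists (j :: s), z; split=> //=; [rewrite sn|rewrite yE].
Qed.

Lemma attractor_closed : closed K.
Proof. by case: hK => _ cK _; apply: compact_closed. Qed.

Lemma expr_lt_ex (e : R) : 0 < e -> exists n, rho ^+ n < e.
Proof.
move=> e0.
have /cvgrPdist_lt/(_ e e0)[n _ /(_ n (leqnn n))] :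
  (rho ^+ n @[n --> \oo] --> (0 : R)).
  by apply: cvg_expr; rewrite ger0_norm// ltW.
rewrite /= sub0r normrN ger0_norm ?exprn_ge0 ?(ltW rho0)// => h.
by exists n.
Qed.

Hypothesis hd0 : d ord0 = 0.
Hypothesis hd : forall i j : 'I_k.+1, (i < j)%N -> d i < d j.

Let dge0 j : 0 <= d j.
Proof.
case: (posnP j) => [j0|j0]; last by rewrite -hd0 ltW// hd.
have -> : j = ord0 by exact/val_inj.
by rewrite hd0.
Qed.

Let dle j : d j <= d ord_max.
Proof.
have := leq_ord j; rewrite leq_eqVlt => /orP[/eqP jk|jk]; last first.
  by rewrite ltW// hd.
have -> : j = ord_max by exact/val_inj.
by [].
Qed.

(** By compactness [K] has a maximum [M]; writing [M = S j y] with [y] in [K] gives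
    [M <= rho * M + d ord_max]. The minimum is treated alike. *)
Lemma attractor_itv x : K x -> 0 <= x <= delta rho d.
Proof.
have [K0 cK E] := hK.
have cid : {within K, continuous (fun x : R => x)}.
  by apply: continuous_subspaceT => y; exact: cvg_id.
have [M KM maxM] : exists2 M : R, K M & forall y, K y -> y <= M.
  have [M /set_mem KM maxM] := compact_EVT_max K0 cK cid.
  by exists M => // y Ky; apply: maxM; rewrite inE.
have [m Km minm] : exists2 m : R, K m & forall y, K y -> m <= y.
  have [m /set_mem Km minm] := compact_EVT_min K0 cK cid.
  by exists m => // y Ky; apply: minm; rewrite inE.
move=> Kx; apply/andP; split.
  apply: le_trans (minm _ Kx).
  move: (Km); rewrite {1}E => {E} -[j _ [y Ky]].
  have := minm _ Ky; have := dge0 j; rewrite /ifs_map => dj my mE.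
  have : rho * m <= m by rewrite -{2}mE; have := ler_wpM2l (ltW rho0) my; lra.
  move=> h; have : 0 <= (1 - rho) * m by lra.
  by rewrite pmulr_rge0 ?subr_gt0.
apply: (le_trans (maxM _ Kx)).
move: (KM); rewrite {1}E => {E} -[j _ [y Ky]].
have := maxM _ Ky; have := dle j; rewrite /ifs_map => dj My ME.
have h : M <= rho * M + d ord_max.
  by rewrite -{1}ME; have := ler_wpM2l (ltW rho0) My; lra.
by rewrite /delta mulrC ler_pdivlMr ?subr_gt0//; lra.
Qed.

(** As [d ord0 = 0], the origin is the fixed point of [S ord0], hence the limit of its iterates at
    any point of the closed set [K]. *)
Lemma attractor0 : K 0.
Proof.
have [[x Kx] _ _] := hK.
apply: (@closed_cvg _ _ \oo _ (fun n => W (nseq n ord0) x) K attractor_closed).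
  by apply: nearW => n; exact: attractor_word.
have -> : (fun n => W (nseq n ord0) x) = (fun n => rho ^+ n * x).
  apply/funext; elim => [|n IH] /=; first by rewrite expr0 mul1r.
  by rewrite IH /ifs_map hd0 exprS addr0 mulrA.
rewrite -[X in _ --> X](mul0r x); apply: cvgMr_tmp.
by apply: cvg_expr; rewrite ger0_norm// ltW.
Qed.

Hypothesis hssc : strong_separation rho d K.

(** The distance attains its minimum on a product of compact sets, and disjointness of the two
    pieces makes this minimum positive. *)
Let pair_gap i j : i != j ->
  exists2 e, 0 < e & forall x y, K x -> K y -> e <= `|S i x - S j y|.
Proof.
move=> ij; have [K0 cK _] := hK.
have cS l : continuous (S l).
  by move=> x; apply: cvgD; [apply: cvgMl_tmp; exact: cvg_id|exact: cvg_cst].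
have cf : continuous (fun z : R * R => `|S i z.1 - S j z.2|).
  move=> z; apply: cvg_norm; apply: cvgB.
    by apply: (@cvg_comp _ _ _ fst (S i)); [exact: cvg_fst|exact: cS].
  by apply: (@cvg_comp _ _ _ snd (S j)); [exact: cvg_snd|exact: cS].
have [|||[u v] /set_mem[/= Ku Kv] umin] :=
    @compact_EVT_min _ _ (fun z : R * R => `|S i z.1 - S j z.2|) (K `*` K).
- by case: K0 => x Kx; exists (x, x).
- exact: compact_setX.
- exact: continuous_subspaceT.
exists `|S i u - S j v|.
  rewrite normr_gt0 subr_eq0; apply/eqP => E.
  case/eqP: ij; apply: hssc => //.
  by exists (S i u); split; [exists u|rewrite E; exists v].
by move=> x y Kx Ky; have := umin (x, y); apply; rewrite inE; split.
Qed.

Lemma attractor_gap : exists2 e, 0 < e &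
  forall i j x y, i != j -> K x -> K y -> e <= `|S i x - S j y|.
Proof.
have /choice[e eP] (ij : 'I_k.+1 * 'I_k.+1) : exists e, 0 < e /\
    (ij.1 != ij.2 ->
     forall x y, K x -> K y -> e <= `|S ij.1 x - S ij.2 y|).
  case: ij => i j /=.
  have [->|ij] := eqVneq i j; first by exists 1.
  by have [e e0 eP] := pair_gap ij; exists e.
exists (\big[Num.min/1]_ij e ij).
  elim/big_ind: _ => [//|x y x0 y0|ij _]; first by rewrite lt_min x0.
  by case: (eP ij).
move=> i j x y ij Kx Ky; apply: le_trans ((eP (i, j)).2 ij x y Kx Ky).
exact: bigmin_le.
Qed.

End attractor.

(** * Separation of pieces of equal level *)

Section word_gap.
Variables (R : realType) (k : nat) (rho : R) (d : 'I_k.+1 -> R) (K : set R).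
Variable e : R.
Hypothesis hrho : 0 < rho < 1.
Hypothesis hK : self_similar_set rho d K.
Hypothesis e0 : 0 < e.
Hypothesis gap : forall i j x y, i != j -> K x -> K y ->
  e <= `|ifs_map rho d i x - ifs_map rho d j y|.
Local Notation W := (ifs_word rho d).

(** Stripping a common first letter divides the distance by [rho]; at the first differing letter
    [gap] applies. *)
Lemma word_gap s t x y : size s = size t -> s != t -> K x -> K y ->
  e * rho ^+ size s <= `|W s x - W t y|.
Proof.
have [rho0 rho1] := andP hrho.
move=> + + Kx Ky; elim: s t => [|i s IH] [|j t]//= [st].
have [<-|ij _] := eqVneq i j.
  rewrite eqseq_cons eqxx /= => /IH -/(_ st) h.
  rewrite /ifs_map opprD addrACA subrr addr0 -mulrBr normrM (gtr0_norm rho0).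
  by rewrite exprS mulrCA ler_pM2l.
have := gap ij (attractor_word hK s Kx) (attractor_word hK t Ky).
apply: le_trans; rewrite ger_pMr//.
by rewrite exprn_ile1 ?ltW.
Qed.

Lemma word_inj s t x y : size s = size t -> K x -> K y -> W s x = W t y -> s = t.
Proof.
have [rho0 _] := andP hrho.
move=> st Kx Ky E; apply/eqP/negPn/negP => nst.
have := word_gap st nst Kx Ky.
by rewrite E subrr normr0 leNgt mulr_gt0// exprn_gt0.
Qed.

End word_gap.

(** * Counting words in sparse trees *)

(** For positive [Z], Bernoulli's inequality bounds [(1 + 1/Z)^q] below by [1 + q/Z], which exceeds
    [C] at [q = Z * C]. *)
Lemma exp_succ_unbounded Z C : ~ (forall q, (Z.+1 ^ q <= C * Z ^ q)%N).
Proof.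
move=> h; case: (posnP Z) => [Z0|Z0].
  by have := h 1%N; rewrite Z0 expn1 muln0.
have bern q : (Z ^ q * (Z + q) <= Z * Z.+1 ^ q)%N.
  elim: q => [|q IH]; first by rewrite !expn0 addn0 mul1n muln1.
  by rewrite !expnS; nia.
have := leq_trans (bern (Z * C)%N) (leq_mul (leqnn Z) (h _)).
by rewrite mulnA mulnC leq_pmul2r ?expn_gt0 ?Z0//; lia.
Qed.

(** [D] is a prefix-closed tree. From depth [n] on, each node misses a descendant [L] levels below,
    so every block of [L] levels multiplies the count by at most [(#|T| ^ L).-1]. *)
Lemma card_sparse_tree (T : finType) (D : pred (seq T)) n L :
    (forall s t, D (s ++ t) -> D s) ->
    (forall s, (n <= size s)%N -> exists2 t, size t = L & ~~ D (s ++ t)) ->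
  forall q, (#|[set s : (n + L * q).-tuple T | D s]%SET|
             <= #|T| ^ n * (#|T| ^ L).-1 ^ q)%N.
Proof.
move=> Dcat Dmiss; elim=> [|q IH].
  by rewrite expn0 muln1 muln0 addn0 -card_tuple max_card.
have -> : (n + L * q.+1 = (n + L * q) + L)%N by rewrite mulnS; lia.
set a := (n + L * q)%N in IH *.
have /choice[t tP] (s : a.-tuple T) : exists t : L.-tuple T, ~~ D (s ++ t).
  have [|t tL Dt] := Dmiss s; first by rewrite size_tuple leq_addr.
  by exists (Tuple (introT eqP tL)).
pose E := [set u : a.-tuple T * L.-tuple T | D u.1 && (u.2 != t u.1)]%SET.
have sub : [set s : (a + L).-tuple T | D s]%SET \subset
    (fun u => cat_tuple u.1 u.2) @: E.
  apply/fintype.subsetP => s; rewrite inE => Ds.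
  have s1 : size (take a s) == a by rewrite size_takel// size_tuple leq_addr.
  have s2 : size (drop a s) == L by rewrite size_drop size_tuple addKn.
  apply/imsetP; exists (Tuple s1, Tuple s2); last first.
    by apply/val_inj; rewrite /= cat_take_drop.
  rewrite inE /=; apply/andP; split.
    by apply: (Dcat _ (drop a s)); rewrite cat_take_drop.
  apply/eqP => E2; have := tP (Tuple s1).
  by rewrite -E2 /= cat_take_drop Ds.
apply: leq_trans (subset_leq_card sub) _.
apply: leq_trans (leq_imset_card _ _) _.
have -> : (#|E| = \sum_(s : a.-tuple T | D s) (#|T| ^ L).-1)%N.
  rewrite -sum1_card /E.
  transitivity (\sum_(s : a.-tuple T | D s) \sum_(v : L.-tuple T | v != t s) 1)%N.
    by rewrite pair_big_dep /=; apply: eq_bigl => u; rewrite inE.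
  apply: eq_bigr => s Ds; rewrite sum1_card.
  have := cardC1 (t s); rewrite card_tuple => <-.
  by apply: eq_card => v; rewrite ?inE.
rewrite sum_nat_const expnSr mulnA leq_mul2r.
apply/orP; right; apply: leq_trans IH; apply: subset_leq_card.
by apply/fintype.subsetP => s; rewrite !inE.
Qed.

(** * Finite type and the isolating word *)

Section isolation.
Variables (R : realType) (k : nat) (rho : R) (d : 'I_k.+1 -> R) (K : set R).
Hypothesis hrho : 0 < rho < 1.
Hypothesis hK : self_similar_set rho d K.
Hypothesis hd0 : d ord0 = 0.
Hypothesis hd : forall i j : 'I_k.+1, (i < j)%N -> d i < d j.
Hypothesis hft : finite_type_torus rho d.
Local Notation W := (ifs_word rho d).
Local Notation delta := (delta rho d).

Let rho0 : 0 < rho. Proof. by case/andP: hrho. Qed.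
Let K0 : K 0. Proof. exact: (attractor0 hrho hK hd0). Qed.
Let Kitv x : K x -> 0 <= x <= delta. Proof. exact: (attractor_itv hrho hK). Qed.

Let delta0 : 0 <= delta. Proof. by case/andP: (Kitv K0). Qed.

Let rho_gt0 n : 0 < rho ^+ n. Proof. exact: exprn_gt0. Qed.

Let rho_le m n : (m <= n)%N -> rho ^+ n <= rho ^+ m.
Proof. by move=> mn; apply: ler_wiXn2l => //; case/andP: hrho => /ltW + /ltW. Qed.

Lemma attractor_dist x y : K x -> K y -> `|x - y| <= delta.
Proof.
move=> /Kitv/andP[x0 x1] /Kitv/andP[y0 y1].
by rewrite ler_norml; apply/andP; split; lra.
Qed.

Lemma expr_delta_lt eps : 0 < eps ->
  exists n0, forall n, (n0 <= n)%N -> rho ^+ n * delta < eps.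
Proof.
move=> eps0; have d1 : 0 < delta + 1 by rewrite ltr_wpDl.
have [n0 n0P] := expr_lt_ex hrho (divr_gt0 eps0 d1).
exists n0 => n /rho_le h; move: n0P; rewrite ltr_pdivlMr// => n0P.
have := exprn_gt0 n rho0 => n1; nra.
Qed.

(** Some ball about [x] avoids [C], and the piece of level [n] through [x] has diameter at most
    [rho ^+ n * delta]. *)
Lemma attractor_zoom (C : set R) x : closed C -> K x -> ~ C x ->
  exists n0, forall n, (n0 <= n)%N ->
    exists2 s, size s = n & forall y, K y -> ~ C (W s y).
Proof.
move=> Ccl Kx Cx.
have /nbhs_ballP[eps eps0 epsP] : nbhs x (~` C).
  by apply: open_nbhs_nbhs; split => //; rewrite openC.
have [n0 n0P] := expr_delta_lt eps0.
exists n0 => n /n0P nP; have [s [z [sn Kz xE]]] := attractor_wordP hK n Kx.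
exists s => // y Ky; apply: epsP; rewrite /ball /= xE ifs_wordB sn.
rewrite normrM gtr0_norm ?exprn_gt0//; apply: le_lt_trans nP.
by rewrite ler_pM2l ?exprn_gt0// attractor_dist.
Qed.

(** Once [rho ^+ n * delta < 1/2], a translate within this bound realises the torus distance, so
    finite type controls differences on the line. *)
Lemma finite_offsets : exists (N : nat) (f : 'I_N -> R) (n0 : nat),
  forall s t (m : int), (n0 <= size s)%N -> size s = size t ->
    `|W s 0 - W t 0 - m%:~R| <= rho ^+ size s * delta ->
    exists i, W s 0 - W t 0 - m%:~R = rho ^+ size s * f i.
Proof.
have [F /finite_seqP[sF ->] FP] := hft.
(* Finite type controls only the absolute value, so both signs are listed. *)
pose L := sF ++ map -%R sF.
exists (size L), (fun i => L`_i).
have [n0 n0P] : exists n0, forall n, (n0 <= n)%N -> rho ^+ n * delta < 2^-1.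
  by apply: expr_delta_lt; rewrite invr_gt0.
exists n0.+1 => s t m ns st xle.
set x := _ - m%:~R in xle *.
have x2 : `|x| < 2^-1 by apply: le_lt_trans xle _; apply: n0P; exact: ltnW.
suff [f [fF xf]] : exists f, f \in sF /\ `|x| = rho ^+ size s * f.
  have [x0|x0] := leP 0 x.
    have fL : f \in L by rewrite mem_cat fF.
    by exists (Ordinal (etrans (index_mem _ _) fL)); rewrite /= nth_index// -xf ger0_norm.
  have fL : - f \in L by rewrite mem_cat map_f ?orbT.
  exists (Ordinal (etrans (index_mem _ _) fL)); rewrite /= nth_index//.
  by rewrite mulrN -xf ltr0_norm// opprK.
have := FP (size s) (leq_ltn_trans (leq0n _) ns) (in_tuple s)
  (Tuple (introT eqP (esym st))).
have -> : mdist (torus_pi (W (in_tuple s) 0))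
    (torus_pi (W (Tuple (introT eqP (esym st))) 0)) = `|x|.
  have [[j jE] jle] := torus_distP (W s 0) (W t 0).
  rewrite [LHS]jE; suff -> : j = - m by rewrite intrN.
  have jx : `|W s 0 - W t 0 + j%:~R| <= `|x|.
    by rewrite -jE /x -intrN.
  (* Translating by [j] and by [- m] both lands within 1/2 of zero, so the two integers agree. *)
  have jm : `|(j + m)%:~R : R| < 1.
    have -> : (j + m)%:~R = (W s 0 - W t 0 + j%:~R) - x :> R.
      by rewrite intrD /x; ring.
    by apply: (le_lt_trans (ler_normB _ _)); lra.
  have : `|j + m| < 1 by rewrite -(ltr_int R) intr_norm.
  by lia.
by case=> [|[f Ff ->]]; [rewrite ltNge xle|exists f].
Qed.

Variable e : R.
Hypothesis e0 : 0 < e.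
Hypothesis gap : forall i j x y, i != j -> K x -> K y ->
  e <= `|ifs_map rho d i x - ifs_map rho d j y|.

(** Otherwise the words [ta] for which [W ta K + m] meets [W sg K] form a sparse tree. Yet at large
    levels they carry all the pieces of [W sg K], at most [N] per word, and the two growth rates are
    incompatible. *)
Lemma inner_piece sg (m : int) : (forall y, K y -> K (W sg y - m%:~R)) ->
  exists ta, forall y, K y -> exists2 z, K z & W ta y + m%:~R = W sg z.
Proof.
move=> AB; apply: contrapT => /forallNP noin.
pose A x := exists2 z, K z & x = W sg z.
have {}noin ta : exists2 y, K y & ~ A (W ta y + m%:~R).
  apply: contrapT => h; apply: (noin ta) => y Ky; apply: contrapT => h'.
  by apply: h; exists y => // -[z Kz E]; apply: h'; exists z.
have [N [f [n0 fP]]] := finite_offsets.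
(* [P G] will be [A] seen from a piece of [K + m] rescaled to [K]: a union of translates of [K] by
   the offsets indexed by [G]. *)
pose P (G : {set 'I_N}) y := exists2 i, i \in G & K (y - f i).
have Pcl G : closed (P G).
  apply: (@closed_bigcup _ _ [set` G] (fun i => (fun y => y - f i) @^-1` K)).
    exact: finite_finpred.
  move=> i _; apply: preimage_closed; last exact: (attractor_closed hK).
  by move=> y _; apply: cvgB; [exact: cvg_id|exact: cvg_cst].
have /choice[l lP] (G : {set 'I_N}) : exists l, (exists2 y, K y & ~ P G y) ->
    forall n, (l <= n)%N ->
    exists2 s, size s = n & forall y, K y -> ~ P G (W s y).
  have [[y Ky Py]|h] := pselect (exists2 y, K y & ~ P G y); last by exists 0%N.
  by have [l lP] := attractor_zoom (Pcl G) Ky Py; exists l.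
(* [G ta] is the relative position of the pieces of [W sg K] around
   [W ta K + m]. It takes finitely many values, so that a missing descendant of
   [W ta K + m] is found at a depth [L] independent of [ta]. *)
pose L := (\max_G l G)%N; pose n1 := maxn n0 (size sg).
pose G ta := [set i : 'I_N | `[< exists2 om, (size sg + size om = size ta)%N &
  W (sg ++ om) 0 = W ta 0 + m%:~R + rho ^+ size ta * f i >]]%SET.
(* Two pieces of this level sharing a point, with inner coordinates [x] and [y], are offset by
   [rho ^+ size ta * (y - x)], so [finite_offsets] applies. *)
have GP ta y : (n1 <= size ta)%N -> K y -> A (W ta y + m%:~R) <-> P (G ta) y.
  rewrite geq_max => /andP[n0ta sgta] Ky; split=> [[z Kz E]|[i]].
    have [om [x [som Kx zE]]] := attractor_wordP hK (size ta - size sg) Kz.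
    have sz : (size sg + size om = size ta)%N by rewrite som subnKC.
    have szc : size (sg ++ om) = size ta by rewrite size_cat.
    have E' : W (sg ++ om) 0 - W ta 0 - m%:~R = rho ^+ size ta * (y - x).
      have := ifs_wordE rho d (sg ++ om) x; have := ifs_wordE rho d ta y.
      by rewrite ifs_word_cat -zE szc -E => -> ?; lra.
    have [|||i iE] := fP (sg ++ om) ta m.
    - by rewrite szc.
    - by [].
    - by rewrite szc E' normrM gtr0_norm// ler_pM2l// attractor_dist.
    have yx : y - x = f i.
      by apply: (mulfI (lt0r_neq0 (rho_gt0 (size ta)))); rewrite -E' iE szc.
    exists i; last by rewrite -yx subKr.
    rewrite inE; apply/asboolP; exists om => //.
    by rewrite -yx -E'; ring.
  rewrite inE => /asboolP[om som E] Ky'.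
  exists (W om (y - f i)); first exact: (attractor_word hK).
  rewrite -ifs_word_cat ifs_wordE [RHS]ifs_wordE E size_cat som; ring.
pose D ta := `[< exists2 y, K y & A (W ta y + m%:~R) >].
have Dcat s t : D (s ++ t) -> D s.
  move=> /asboolP[y Ky Ay]; apply/asboolP; exists (W t y).
    exact: (attractor_word hK).
  by rewrite -ifs_word_cat.
have Dmiss s : (n1 <= size s)%N -> exists2 t, size t = L & ~~ D (s ++ t).
  move=> ns; have [y Ky /(GP s y ns Ky) Py] := noin s.
  have [||t tL tP] := lP (G s) _ L; [by exists y|exact: leq_bigmax|].
  exists t => //; apply/asboolPn => -[z Kz]; rewrite ifs_word_cat.
  by move/(GP s _ ns (attractor_word hK _ Kz)); exact: tP.
have Dcard n : (n1 <= n)%N ->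
    (#|'I_k.+1| ^ (n - size sg) <= N * #|[set s : n.-tuple 'I_k.+1 | D s]%SET|)%N.
  rewrite geq_max => /andP[n0n sgn].
  (* [h om] records a piece of [K + m] containing the left endpoint of [W (sg ++ om) K], and their
     relative offset; together these determine [om]. *)
  have /choice[h hP] (om : (n - size sg).-tuple 'I_k.+1) :
      exists h : 'I_N * n.-tuple 'I_k.+1, D h.2 /\
      W (sg ++ om) 0 = W h.2 0 + m%:~R + rho ^+ n * f h.1.
    have [ta [y [sta Ky E]]] := attractor_wordP hK n (AB _ (attractor_word hK om K0)).
    have szc : size (sg ++ om) = n by rewrite size_cat size_tuple subnKC.
    have E' : W (sg ++ om) 0 - W ta 0 - m%:~R = rho ^+ n * y.
      by rewrite ifs_word_cat; move: E; rewrite ifs_wordE [W ta y]ifs_wordE sta; lra.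
    have [|||i iE] := fP (sg ++ om) ta m; rewrite ?szc//.
      by rewrite E' normrM gtr0_norm// ler_pM2l// ger0_norm; case/andP: (Kitv Ky).
    exists (i, Tuple (introT eqP sta)) => /=; split.
      apply/asboolP; exists y => //; exists (W om 0); first exact: (attractor_word hK).
      by rewrite -E; ring.
    by rewrite szc in iE; rewrite -iE; ring.
  have hinj : injective h.
    move=> u v uv; apply/val_inj.
    have : sg ++ u = sg ++ v.
      apply: (word_inj hrho hK e0 gap _ K0 K0); first by rewrite !size_cat !size_tuple.
      by rewrite (hP u).2 (hP v).2 uv.
    by move/eqP; rewrite eqseq_cat// eqxx /= => /eqP.
  rewrite -card_tuple -(card_codom hinj).
  rewrite -[N in (_ <= N * _)%N]card_ord -cardsT -cardsX.
  apply: subset_leq_card; apply/fintype.subsetP => _ /codomP[om ->].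
  have := hP om; case: (h om) => i t [Dt _].
  by rewrite finset.in_setX finset.in_setT inE.
(* Both counts are taken at level [n1 + L * q]; as [size sg <= n1], the number of pieces of [W sg K]
   is at least [(#|'I_k.+1| ^ L) ^ q]. *)
apply: (@exp_succ_unbounded (#|'I_k.+1| ^ L).-1 (N * #|'I_k.+1| ^ n1)) => q.
have X0 : (0 < #|'I_k.+1|)%N by rewrite card_ord.
rewrite prednK ?expn_gt0 ?X0//.
apply: (@leq_trans (#|'I_k.+1| ^ (n1 + L * q - size sg))%N).
  have : (size sg <= n1)%N by exact: leq_maxr.
  by move=> h; rewrite -expnM leq_pexp2l//; lia.
apply: leq_trans (Dcard _ (leq_addr _ _)) _.
by rewrite -mulnA leq_mul2l (card_sparse_tree Dcat Dmiss) orbT.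
Qed.


(** Since the words have equal length, the second alternative says that [W (sg ++ om) K] is
    [W ta K + m]. If a point of [W sg K - m] is off [K], zooming at it gives the first alternative;
    otherwise [inner_piece] leads to the second. *)
Lemma isolate1 sg (m : int) : exists om,
  (forall y, K y -> ~ K (W (sg ++ om) y - m%:~R)) \/
  (exists2 ta, size ta = size (sg ++ om) & W (sg ++ om) 0 = W ta 0 + m%:~R).
Proof.
have [AB|] := pselect (forall y, K y -> K (W sg y - m%:~R)); last first.
  move=> /existsNP[y /not_implyP[Ky nKy]].
  have Ccl : closed [set y | K (W sg y - m%:~R)].
    apply: (@preimage_closed _ _ (fun y => W sg y - m%:~R) K);
      last exact: (attractor_closed hK).
    move=> z _; apply: cvgB; last exact: cvg_cst.
    have -> : W sg = (fun x => rho ^+ size sg * x + W sg 0).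
      by apply/funext => x; exact: ifs_wordE.
    by apply: cvgD; [apply: cvgMl_tmp; exact: cvg_id|exact: cvg_cst].
  have [n0 /(_ n0 (leqnn n0))[om _ omP]] := attractor_zoom Ccl Ky nKy.
  by exists om; left => z Kz; rewrite ifs_word_cat; exact: omP.
have [ta taP] := inner_piece AB.
(* [W ta K + m] is clopen in both [W sg K] and [K + m], so its least point is
   also the least point of a small piece of [W sg K]. *)
have [n1 n1P] := expr_delta_lt (mulr_gt0 e0 (rho_gt0 (size ta))).
pose n := maxn n1 (maxn (size sg) (size ta)).
have [n1n sgn tan] : [/\ n1 <= n, size sg <= n & size ta <= n]%N.
  by rewrite /n !leq_max !leqnn !orbT.
have {n1P} nP := n1P n n1n.
have [z Kz E] := taP 0 K0.
have [om [x [som Kx zE]]] := attractor_wordP hK (n - size sg) Kz.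
have szc : size (sg ++ om) = n by rewrite size_cat som subnKC.
have {}E : W ta 0 + m%:~R = W (sg ++ om) 0 + rho ^+ n * x.
  by rewrite E zE -ifs_word_cat ifs_wordE szc addrC.
have [ta' [y [sta Ky tE]]] :=
  attractor_wordP hK (size ta) (AB _ (attractor_word hK om K0)).
rewrite -ifs_word_cat in tE.
have [x0 x1] := andP (Kitv Kx).
(* The left endpoint of the small piece, shifted by [- m], is closer to [W ta 0] than the gap at the
   level of [ta], which forces [ta' = ta]. *)
have [tt|tt] := eqVneq ta' ta; last first.
  have := word_gap hrho hK e0 gap sta tt Ky K0; rewrite sta leNgt => /negP[].
  apply: le_lt_trans nP.
  have -> : W ta' y - W ta 0 = - (rho ^+ n * x) by lra.
  by rewrite normrN normrM gtr0_norm// ger0_norm// ler_pM2l.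
(* Neither left endpoint lies to the right of the other: two nonnegative displacements add up to
   zero. *)
have xy : rho ^+ n * x + rho ^+ size ta * y = 0.
  by move: tE; rewrite tt [W ta y]ifs_wordE; lra.
have x00 : rho ^+ n * x = 0.
  have := mulr_ge0 (ltW (rho_gt0 n)) x0.
  have := mulr_ge0 (ltW (rho_gt0 (size ta))) (proj1 (andP (Kitv Ky))).
  by move: xy; lra.
(* Padding with [ord0] brings [ta] to level [n] without moving the left endpoint. *)
exists om; right; exists (ta ++ nseq (n - size ta) ord0).
  by rewrite szc size_cat size_nseq subnKC.
rewrite [in RHS]ifs_word_cat.
have -> : W (nseq (n - size ta) ord0) 0 = 0.
  by elim: (n - size ta)%N => //= j IH; rewrite IH /ifs_map mulr0 hd0 addr0.
by rewrite E x00 addr0.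
Qed.

(* Both alternatives pass to the subpieces of [W sg K], so the integers can be
   handled one after the other. *)
Lemma isolating_word (ms : seq int) : exists sg, forall m, m \in ms ->
  (forall y, K y -> ~ K (W sg y - m%:~R)) \/
  (exists2 ta, size ta = size sg & W sg 0 = W ta 0 + m%:~R).
Proof.
elim: ms => [|m ms [sg sgP]]; first by exists [::].
have [om omP] := isolate1 sg m.
exists (sg ++ om) => m'; rewrite in_cons => /orP[/eqP->//|/sgP[dis|[ta sta E]]].
  by left => y Ky; rewrite ifs_word_cat; apply/dis/(attractor_word hK).
right; exists (ta ++ om); first by rewrite !size_cat sta.
by rewrite !ifs_word_cat ifs_wordE E [in RHS]ifs_wordE sta; ring.
Qed.

End isolation.

(** * The self-similar measure: support and masses of balls *)

Section self_similar_measure.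
Variables (R : realType) (k : nat) (rho : R) (d p : 'I_k.+1 -> R) (K : set R).
Variables (mu : probability R R) (e : R).
Hypothesis hrho : 0 < rho < 1.
Hypothesis hK : self_similar_set rho d K.
Hypothesis hp : forall j, 0 < p j.
Hypothesis hp1 : \sum_(j < k.+1) p j = 1.
Hypothesis hmu : self_similar_measure rho d p mu.
Hypothesis e0 : 0 < e.
Hypothesis gap : forall i j x y, i != j -> K x -> K y ->
  e <= `|ifs_map rho d i x - ifs_map rho d j y|.
Local Notation S := (ifs_map rho d).
Local Notation W := (ifs_word rho d).

Let rho0 : 0 < rho. Proof. by case/andP: hrho. Qed.

Let mS j A : measurable A -> measurable (S j @^-1` A).
Proof.
move=> mA; rewrite -[X in measurable X]setTI.
apply: (_ : measurable_fun setT (S j)) => //.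
by apply: measurable_funD => //; exact: measurable_funM.
Qed.

Let U r := \bigcup_(y in K) ball y r.

Let mU r : measurable (~` U r).
Proof.
apply: measurableC; apply: open_measurable; apply: bigcup_open => y _.
exact: ball_open.
Qed.

(** Each [S j] maps [K] into itself and contracts by [rho], so the preimage of the left-hand set
    lies in the right-hand one; then average with the weights. *)
Let muU_rho r : (mu (~` U (rho * r)) <= mu (~` U r))%E.
Proof.
rewrite hmu//.
apply: (@le_trans _ _ (\sum_(j < k.+1) (p j)%:E * mu (~` U r))%E).
  apply: lee_sum => j _; apply: lee_wpmul2l; first by rewrite lee_fin ltW.
  apply: le_measure; rewrite ?inE; [exact: mS|exact: mU|].
  move=> x /= nU [y Ky yx]; apply: nU; exists (S j y); first exact: (attractor_map hK).
  move: yx; rewrite /ball /= /ifs_map opprD addrACA subrr addr0 -mulrBr normrM.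
  by rewrite (gtr0_norm rho0) ltr_pM2l.
rewrite -ge0_sume_distrl; last by move=> j _; rewrite lee_fin ltW.
by rewrite sumEFin hp1 mul1e.
Qed.

(** Iterating [muU_rho] compares with complements of ever larger neighbourhoods, which decrease to
    the empty set. *)
Let muU r : 0 < r -> mu (~` U r) = 0%E.
Proof.
move=> r0; apply/eqP; rewrite eq_le measure_ge0 andbT.
pose F n := ~` U (r / rho ^+ n).
have FE n : (mu (~` U r) <= mu (F n))%E.
  elim: n => [|n IH]; first by rewrite /F expr0 divr1.
  apply: (le_trans IH); rewrite /F.
  suff -> : r / rho ^+ n = rho * (r / rho ^+ n.+1) by exact: muU_rho.
  by rewrite exprS; field; rewrite ?expf_neq0 gt_eqF.
have F0 : \bigcap_n F n = set0.
  apply/seteqP; split=> // x Fx; have [[y Ky] _ _] := hK.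
  have z0 : 0 < r / (`|y - x| + 1) by rewrite divr_gt0// ltr_wpDl.
  have [n nP] := expr_lt_ex hrho z0.
  apply: (Fx n I); exists y => //; rewrite /ball /=.
  move: nP; rewrite ltr_pdivlMr ?ltr_wpDl// => nP.
  rewrite ltr_pdivlMr ?exprn_gt0//; apply: le_lt_trans nP.
  by rewrite mulrC ler_pM2l ?exprn_gt0// lerDl.
rewrite -(measure0 mu) -F0.
apply: (@cvge_ge _ \oo _ _ (mu \o F)); first by apply: nearW => n; exact: FE.
apply: nonincreasing_cvg_mu.
- by rewrite (le_lt_trans (probability_le1 _ _))// ?ltry//; exact: mU.
- by move=> i; exact: mU.
- by rewrite F0; exact: measurable0.
- move=> m n mn; apply/subsetPset; apply: subsetC => x [y Ky yx]; exists y => //.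
  move: yx; rewrite /ball /= => /lt_le_trans; apply.
  rewrite ler_pM2l// lef_pV2 ?posrE ?exprn_gt0//.
  by apply: ler_wiXn2l => //; case/andP: hrho => /ltW + /ltW.
Qed.

Lemma mu_off_attractor A : measurable A -> A `&` K = set0 -> mu A = 0%E.
Proof.
move=> mA AK; apply: measure_negligible => //.
apply: (@negligibleS _ _ _ _ (\bigcup_n ~` U (rho ^+ n))); last first.
  apply: negligible_bigcup => n; apply/negligibleP; first exact: mU.
  by apply: muU; exact: exprn_gt0.
move=> x Ax; apply: contrapT => h.
have nKx : ~ K x by move=> Kx; rewrite -[False]/(set0 x) -AK.
have /nbhs_ballP[eps eps0 epsP] : nbhs x (~` K).
  apply: open_nbhs_nbhs; split => //; rewrite openC.
  exact: (attractor_closed hK).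
have [n nP] := expr_lt_ex hrho eps0.
apply: h; exists n => // -[y Ky yx]; apply: (epsP y) => //.
by apply: ball_sym; apply: le_ball yx; exact: ltW.
Qed.

(** By [gap], a ball of radius at most [e] about a point of one piece meets no other, so a single
    term of the self-similarity sum survives. *)
Lemma mu_ball_map j z r : K z -> rho * r <= e ->
  mu (ball (S j z) (rho * r)) = ((p j)%:E * mu (ball z r))%E.
Proof.
move=> Kz re; rewrite hmu; last exact: measurable_ball.
rewrite (bigD1 j)//= big1 ?adde0.
  congr (_ * mu _)%E; apply/seteqP; rewrite /ball /ball_ /=.
  split=> x /=; rewrite /ifs_map opprD addrACA subrr addr0 -mulrBr normrM;
    by rewrite (gtr0_norm rho0) ltr_pM2l.
move=> i ij; rewrite mu_off_attractor ?mule0//.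
  by apply: mS; exact: measurable_ball.
rewrite -subset0 => x [/= + Kx]; rewrite /ball /=.
by move/lt_le_trans => /(_ _ re); rewrite ltNge gap// eq_sym.
Qed.

Lemma mu_ball_word s z r : K z -> 0 <= r -> rho * r <= e ->
  mu (ball (W s z) (rho ^+ size s * r)) =
  ((\prod_(j <- s) p j)%:E * mu (ball z r))%E.
Proof.
move=> Kz r0 re; elim: s => [|j s IH] /=.
  by rewrite expr0 mul1r big_nil mul1e.
rewrite exprS -mulrA mu_ball_map ?IH ?big_cons ?EFinM ?muleA//.
  exact: (attractor_word hK).
apply: le_trans re; rewrite ler_pM2l// ler_piMl//.
by apply: exprn_ile1; case/andP: hrho => /ltW + /ltW.
Qed.

(** Only the term of the first letter is kept in the self-similarity sum; for the empty word, [A]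
    contains [K] and has full mass. *)
Lemma mu_word_ge s A : measurable A -> (forall y, K y -> A (W s y)) ->
  ((\prod_(j <- s) p j)%:E <= mu A)%E.
Proof.
elim: s A => [|j s IH] A mA sA.
  have mCA : measurable (~` A) by exact: measurableC.
  rewrite big_nil -[A]setCK (probability_setC _ mCA) mu_off_attractor ?sube0//.
  by rewrite -subset0 => x [nA /sA].
rewrite hmu// (bigD1 j)//= big_cons EFinM.
apply: le_trans (leeDl _ _); last first.
  by apply: sume_ge0 => i _; rewrite mule_ge0// lee_fin ltW.
apply: lee_wpmul2l; first by rewrite lee_fin ltW.
by apply: IH; [exact: mS|move=> y /sA].
Qed.

End self_similar_measure.

(** * From power bounds to local dimensions *)

Section power_bounds.
Variables (R : realType) (T : pseudoMetricType R) (nu : set T -> \bar R).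

(** As [ln r < 0] near zero, this bounds the local dimension from above, and [ball_le] bounds it
    from below. *)
Definition ball_ge (x : T) (t : R) := exists2 c : R, 0 < c &
  exists2 r1 : R, 0 < r1 & forall r : R, 0 < r < r1 ->
  ((c * r `^ t)%:E <= nu (ball x r))%E.

Definition ball_le (x : T) (t : R) := exists2 c : R, 0 < c &
  exists2 r1 : R, 0 < r1 & forall r : R, 0 < r < r1 ->
  (nu (ball x r) <= (c * r `^ t)%:E)%E.

Let near_right (a : R) : 0 < a -> \forall r \near (0:R)^'+, 0 < r < a.
Proof.
move=> a0; near=> r; apply/andP; split; near: r; first exact: nbhs_right_gt.
exact: nbhs_right_lt.
Unshelve. all: by end_near. Qed.

Let ln_ratio (c t : R) : (t + ln c / ln r)%:E @[r --> (0:R)^'+] --> t%:E.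
Proof.
apply: cvg_EFin; first by apply: nearW.
rewrite -[X in _ --> X]addr0; apply: cvgD; first exact: cvg_cst.
rewrite -[X in _ --> X](mulr0 (ln c)); apply: cvgMl_tmp.
apply: (proj2 (ltr0_cvgV0 _)); last exact: lnNy.
apply: filterS (near_right ltr01) => r /andP[r0 r1].
by rewrite ln_lt0// r0.
Qed.

Let ratioE (c t r : R) : 0 < c -> 0 < r < 1 ->
  ln (c * r `^ t) / ln r = t + ln c / ln r.
Proof.
move=> c0 r01; have [r0 r1] := andP r01.
have lr : ln r != 0 by rewrite lt_eqF// ln_lt0.
rewrite lnM ?posrE ?powR_gt0// ln_powR; by field.
Qed.

(** After division by [ln r] a constant [c] contributes [ln c / ln r], which vanishes in the
    limit. *)
Lemma locdim_bounds x a b : ball_ge x b -> ball_le x a ->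
  (forall l, has_locdim nu x l -> (a%:E <= l <= b%:E)%E) /\
  (a = b -> has_locdim nu x a%:E).
Proof.
move=> [c c0 [r1 r10 hge]] [C C0 [r2 r20 hle]].
have near_h : \forall r \near (0:R)^'+,
    ((a + ln C / ln r)%:E <= lne (nu (ball x r)) / (ln r)%:E <= (b + ln c / ln r)%:E)%E.
  have m0 : 0 < Num.min 1 (Num.min r1 r2) by rewrite !lt_min ltr01 r10.
  apply: filterS (near_right m0) => r /andP[r0]; rewrite !lt_min => /and3P[rl1 rr1 rr2].
  have r01 : 0 < r < 1 by rewrite r0.
  have {}hge := hge r (introT andP (conj r0 rr1)).
  have {}hle := hle r (introT andP (conj r0 rr2)).
  have lr : ln r < 0 by rewrite ln_lt0.
  case: (nu (ball x r)) hge hle => [v| |]; rewrite ?leeNy_eq ?leye_eq//.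
  rewrite !lee_fin => hge hle.
  have cr0 : 0 < c * r `^ b by rewrite mulr_gt0// powR_gt0.
  have v0 : 0 < v by exact: lt_le_trans hge.
  rewrite lne_EFin// inver (lt_eqF lr) -EFinM !lee_fin -!ratioE//.
  by rewrite !ler_nM2r ?invr_lt0// !ler_ln ?posrE ?hge ?hle// (lt_le_trans v0).
split=> [l|ab]; last first.
  apply: (squeeze_cvge near_h); first exact: ln_ratio.
  by rewrite ab; exact: ln_ratio.
rewrite /has_locdim => hl; apply/andP; split.
  apply: (lee_cvg_to (@ln_ratio C a) hl).
  by apply: filterS near_h => r /andP[].
apply: (lee_cvg_to hl (@ln_ratio c b)).
by apply: filterS near_h => r /andP[].
Qed.

End power_bounds.

(** * Masses of balls at coded points, and points of prescribed exponent *)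

Section regular_points.
Variables (R : realType) (k : nat) (rho : R) (d p : 'I_k.+1 -> R) (K : set R).
Variables (mu : probability R R) (e : R).
Hypothesis hrho : 0 < rho < 1.
Hypothesis hK : self_similar_set rho d K.
Hypothesis hp : forall j, 0 < p j.
Hypothesis hp1 : \sum_(j < k.+1) p j = 1.
Hypothesis hmu : self_similar_measure rho d p mu.
Hypothesis e0 : 0 < e.
Hypothesis gap : forall i j x y, i != j -> K x -> K y ->
  e <= `|ifs_map rho d i x - ifs_map rho d j y|.
Hypothesis hd0 : d ord0 = 0.
Hypothesis hd : forall i j : 'I_k.+1, (i < j)%N -> d i < d j.
Local Notation S := (ifs_map rho d).
Local Notation W := (ifs_word rho d).
Local Notation P s := (\prod_(j <- s) p j).

Let rho0 : 0 < rho. Proof. by case/andP: hrho. Qed.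
Let rhoX n : 0 < rho ^+ n. Proof. exact: exprn_gt0. Qed.
Let rhor0 : rho * (e / rho) = e. Proof. by rewrite mulrC divfK// gt_eqF. Qed.
Let r0_gt0 : 0 < e / rho. Proof. exact: divr_gt0. Qed.

Lemma prod_word_gt0 s : 0 < P s.
Proof. by apply: prodr_gt0 => j _; exact: hp. Qed.

Let prod_ge q s : 0 <= q -> (forall j, q <= p j) -> q ^+ size s <= P s.
Proof.
move=> q0 qp; elim: s => [|j s IH]; first by rewrite big_nil.
by rewrite big_cons exprS ler_pM// exprn_ge0.
Qed.

Let prod_le q s : (forall j, p j <= q) -> P s <= q ^+ size s.
Proof.
move=> qp; elim: s => [|j s IH]; first by rewrite big_nil.
by rewrite big_cons exprS ler_pM// ltW// ?prod_word_gt0.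
Qed.

Let scale r : 0 < r <= e / rho ->
  exists n, rho ^+ n * e < r <= rho ^+ n * (e / rho).
Proof.
move=> /andP[r0 re].
have [m mP] := expr_lt_ex hrho (divr_gt0 r0 r0_gt0).
have ex : exists m, rho ^+ m * (e / rho) < r by exists m; rewrite -ltr_pdivlMr.
case: (ex_minnP ex) => -[|n]; first by rewrite expr0 mul1r ltNge re.
rewrite exprSr -mulrA rhor0 => ne nmin; exists n; rewrite ne leNgt.
by apply/negP => /nmin; rewrite ltnn.
Qed.

(** At a level [n] independent of [z], the piece through [z] lies in the ball, and its weight is at
    least [q ^+ n]. *)
Let base : exists2 c, 0 < c & forall z, K z -> (c%:E <= mu (ball z (e / rho)))%E.
Proof.
pose q := \big[Num.min/p ord0]_j p j.
have q0 : 0 < q.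
  by rewrite /q; elim/big_ind: _ => // x y x0 y0; rewrite lt_min x0.
have qp j : q <= p j by exact: bigmin_le.
have [n /(_ n (leqnn n)) nP] := expr_delta_lt hrho hK hd0 hd r0_gt0.
exists (q ^+ n); first exact: exprn_gt0.
move=> z Kz; have [s [y [sn Ky zE]]] := attractor_wordP hK n Kz.
apply: (@le_trans _ _ (P s)%:E); first by rewrite lee_fin -sn prod_ge// ltW.
apply: (mu_word_ge hrho hK hp hp1 hmu); first exact: measurable_ball.
move=> x Kx; rewrite /ball /= zE ifs_wordB sn normrM gtr0_norm//.
by apply: le_lt_trans nP; rewrite ler_pM2l// (attractor_dist hrho hK hd0 hd).
Qed.

Let le_mu_ball x r r' : r <= r' -> (mu (ball x r) <= mu (ball x r'))%E.
Proof.
by move=> rr; apply: le_measure; rewrite ?inE; [exact: measurable_ball..|exact: le_ball].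
Qed.

Definition coded_le (t C z : R) := forall n, exists s z',
  [/\ size s = n, K z', z = W s z' & P s <= C * (rho ^+ n) `^ t].

Definition coded_ge (t C z : R) := forall n, exists s z',
  [/\ size s = n, K z', z = W s z' & C * (rho ^+ n) `^ t <= P s].

(** The ball is enlarged to radius [rho ^+ n * (e / rho)], where [mu_ball_word] bounds its mass by
    [P s]; [C'] comes from [rho ^+ n < r / e]. Its uniformity in [z] serves [ball_le_nearby]. *)
Lemma mu_ball_le (t C : R) : 0 <= t -> 0 < C -> exists2 C' : R, 0 < C' &
  forall z, K z -> coded_le t C z -> forall r : R, 0 < r < e / rho ->
  (mu (ball z r) <= (C' * r `^ t)%:E)%E.
Proof.
move=> t0 C0; exists (C * e^-1 `^ t); first by rewrite mulr_gt0// powR_gt0// invr_gt0.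
move=> z Kz zC r /andP[r0 /ltW re].
have [n /andP[nr rn]] := scale (introT andP (conj r0 re)).
have [s [z' [sn Kz' zE sC]]] := zC n.
apply: (le_trans (le_mu_ball z rn)).
rewrite zE -sn (mu_ball_word hrho hK hp hp1 hmu gap)// ?rhor0// ?(ltW r0_gt0)//.
apply: (@le_trans _ _ (P s)%:E).
  rewrite -[leRHS]mule1; apply: lee_wpmul2l; first by rewrite lee_fin ltW// prod_word_gt0.
  by apply: probability_le1; exact: measurable_ball.
rewrite lee_fin; apply: (le_trans sC); rewrite -mulrA ler_pM2l//.
have ei0 : 0 <= e^-1 by rewrite invr_ge0 ltW.
rewrite -(powRM _ ei0 (ltW r0)).
apply: (ge0_ler_powR t0); rewrite ?nnegrE ?mulr_ge0// ?(ltW r0) ?(ltW (rhoX n))//.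
by rewrite mulrC ler_pdivlMr// ltW.
Qed.

Lemma mu_ball_ge (t C : R) : 0 <= t -> 0 < C -> exists2 C' : R, 0 < C' &
  forall z, K z -> coded_ge t C z -> forall r : R, 0 < r < e / rho ->
  ((C' * r `^ t)%:E <= mu (ball z r))%E.
Proof.
move=> t0 C0; have [c c0 cP] := base.
exists (C * c * (rho / (e / rho)) `^ t).
  by rewrite !mulr_gt0// powR_gt0// divr_gt0.
move=> z Kz zC r /andP[r0 /ltW re].
have [n /andP[nr rn]] := scale (introT andP (conj r0 re)).
(* One level deeper than in the upper bound, so that the scaled ball fits inside [ball z r]. *)
have [s [z' [sn Kz' zE sC]]] := zC n.+1.
have nr' : rho ^+ size s * (e / rho) <= r.
  by rewrite sn exprSr -mulrA rhor0 ltW.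
apply: le_trans (le_mu_ball z nr').
rewrite zE (mu_ball_word hrho hK hp hp1 hmu gap)// ?rhor0// ?(ltW r0_gt0)//.
apply: (@le_trans _ _ ((P s)%:E * c%:E)%E); last first.
  by apply: lee_wpmul2l; [rewrite lee_fin ltW// prod_word_gt0|exact: cP].
rewrite -EFinM lee_fin; apply: le_trans (ler_wpM2r (ltW c0) sC).
have q0 : 0 <= rho / (e / rho) by rewrite ltW// divr_gt0.
rewrite -[leLHS]mulrA -(powRM _ q0 (ltW r0)) [leRHS]mulrAC.
apply: ler_wpM2l; first by rewrite ltW// mulr_gt0.
apply: (ge0_ler_powR t0); rewrite ?nnegrE ?(ltW (rhoX _))//.
  exact: mulr_ge0 q0 (ltW r0).
by rewrite exprS -mulrA ler_pM2l// mulrC ler_pdivrMr.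
Qed.

Let word_scale s z t r1 : K z -> 0 < r1 ->
  exists c r2 : R, [/\ 0 < c, 0 < r2 & forall r, 0 < r < r2 ->
  exists r', [/\ 0 < r' < r1, mu (ball (W s z) r) = ((P s)%:E * mu (ball z r'))%E &
  r' `^ t = c * r `^ t]].
Proof.
move=> Kz r10; have n0 := rhoX (size s).
exists ((rho ^+ size s)^-1 `^ t), (rho ^+ size s * Num.min r1 (e / rho)).
have m0 : 0 < Num.min r1 (e / rho) by rewrite lt_min r10.
split; first by rewrite powR_gt0// invr_gt0.
  by rewrite mulr_gt0.
move=> r /andP[r0]; rewrite mulrC -ltr_pdivrMr// lt_min => /andP[rr1 rr2].
exists (r / rho ^+ size s); have r'0 : 0 < r / rho ^+ size s by rewrite divr_gt0.
split; first by rewrite r'0.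
  rewrite -(mu_ball_word hrho hK hp hp1 hmu gap)// ?ltW//.
    by rewrite mulrC divfK// gt_eqF.
  by rewrite -[X in _ < X]rhor0 ltr_pM2l.
by rewrite powRM ?invr_ge0 1?mulrC// ltW.
Qed.

Lemma ball_le_word s z t : K z -> ball_le mu z t -> ball_le mu (W s z) t.
Proof.
move=> Kz [c c0 [r1 r10 h]].
have [c' [r2 [c'0 r20 h2]]] := word_scale s t Kz r10.
exists (P s * (c * c')); first by rewrite !mulr_gt0// prod_word_gt0.
exists r2 => // r /h2[r' [r'1 -> E]].
rewrite -!mulrA -E [leRHS]EFinM; apply: lee_wpmul2l; last exact: h.
by rewrite lee_fin ltW// prod_word_gt0.
Qed.

Lemma ball_ge_word s z t : K z -> ball_ge mu z t -> ball_ge mu (W s z) t.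
Proof.
move=> Kz [c c0 [r1 r10 h]].
have [c' [r2 [c'0 r20 h2]]] := word_scale s t Kz r10.
exists (P s * (c * c')); first by rewrite !mulr_gt0// prod_word_gt0.
exists r2 => // r /h2[r' [r'1 -> E]].
rewrite -!mulrA -E [leLHS]EFinM; apply: lee_wpmul2l; last exact: h.
by rewrite lee_fin ltW// prod_word_gt0.
Qed.

Lemma ball_le_off y t : ~ K y -> ball_le mu y t.
Proof.
move=> nKy.
have /nbhs_ballP[r1 /= r10 sub] : nbhs y (~` K).
  apply: open_nbhs_nbhs; split => //; rewrite openC.
  exact: (attractor_closed hK).
exists 1 => //; exists r1 => // r /andP[r0 /ltW rr1].
rewrite (mu_off_attractor hrho hK hp hp1 hmu); [|exact: measurable_ball|].
  by rewrite lee_fin mul1r powR_ge0.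
by rewrite -subset0 => x [/(le_ball rr1)/sub].
Qed.

(** A ball about [y] either misses [K] or lies in a ball of twice the radius about a point of [K].
    This covers integer translates that leave [K]. *)
Lemma ball_le_nearby (C t r1 : R) : 0 <= t -> 0 < C -> 0 < r1 ->
  (forall z r, K z -> 0 < r < r1 -> (mu (ball z r) <= (C * r `^ t)%:E)%E) ->
  forall y, ball_le mu y t.
Proof.
move=> t0 C0 r10 h y; exists (C * 2 `^ t); first by rewrite mulr_gt0// powR_gt0.
exists (r1 / 2); first by rewrite divr_gt0.
move=> r /andP[r0]; rewrite ltr_pdivlMr// => rr1.
have [[z [yz Kz]]|no] := pselect (ball y r `&` K !=set0); last first.
  rewrite (mu_off_attractor hrho hK hp hp1 hmu); [|exact: measurable_ball|].
    by rewrite lee_fin !mulr_ge0 ?powR_ge0// ltW.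
  by rewrite -subset0 => x yK; apply: no; exists x.
apply: (@le_trans _ _ (mu (ball z (r * 2)))).
  apply: le_measure; rewrite ?inE; [exact: measurable_ball..|].
  move=> x yx; rewrite mulr_natr mulr2n; apply: ball_triangle yx.
  exact: ball_sym.
apply: (le_trans (h _ _ Kz _)); first by rewrite rr1 mulr_gt0.
by rewrite lee_fin powRM ?(ltW r0)// mulrA mulrAC.
Qed.

(** [z n] is the point coded by the sequence [om] shifted by [n]: the limit of the left endpoints of
    its pieces, which increase because [K] has no negative points. *)
Lemma coded_point (om : nat -> 'I_k.+1) : exists z : nat -> R,
  forall n, K (z n) /\ z n = S (om n) (z n.+1).
Proof.
pose v n m := W [seq om (n + i)%N | i <- iota 0 m] 0.
have K0 : K 0 by exact: (attractor0 hrho hK hd0).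
have Kv n m : K (v n m) by exact: (attractor_word hK).
have vS n m : v n m.+1 = S (om n) (v n.+1 m).
  rewrite /v /= addn0; congr (S _ (W _ _)).
  rewrite -[1%N]addn0 iotaDl -map_comp; apply: eq_map => i /=.
  by rewrite addnCA add1n addSn addnC.
have v_nd n : nondecreasing_seq (v n).
  apply/nondecreasing_seqP => m; rewrite /v -[m.+1]addn1 iotaD map_cat.
  rewrite ifs_word_cat add0n.
  rewrite ifs_wordE [leRHS]ifs_wordE mulr0 lerD2r mulr_ge0 ?(ltW (rhoX _))//.
  have := attractor_word hK [seq om (n + i)%N | i <- iota m 1] K0.
  by move=> /(attractor_itv hrho hK hd0 hd)/andP[].
have v_ub n : has_ubound (range (v n)).
  exists (delta rho d) => _ [m _ <-].
  by case/andP: (attractor_itv hrho hK hd0 hd (Kv n m)).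
have v_cvg n := nondecreasing_cvgn (v_nd n) (v_ub n).
exists (fun n => sup (range (v n))) => n; split.
  apply: (@closed_cvg _ _ \oo _ (v n) K (attractor_closed hK)); last exact: v_cvg.
  by apply: nearW => m; exact: Kv.
have h1 : v n m.+1 @[m --> \oo] --> sup (range (v n)).
  by rewrite cvg_shiftS; exact: v_cvg.
have h2 : v n m.+1 @[m --> \oo] --> S (om n) (sup (range (v n.+1))).
  under eq_fun do rewrite vS.
  by apply: cvgD; [apply: cvgMl_tmp; exact: v_cvg|exact: cvg_cst].
exact: cvg_unique h1 h2.
Qed.

(* The code is chosen greedily, so that [ln (P s) - t * size s * ln rho] stays
   bounded along the prefixes [s]. *)
Lemma coded_exponent (t : R) i0 i1 : p i0 <= rho `^ t <= p i1 ->
  exists2 z, K z & exists C1 C2 : R,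
  [/\ 0 < C1, 0 < C2, coded_ge t C1 z & coded_le t C2 z].
Proof.
move=> /andP[p0 p1].
pose u j := ln (p j) - t * ln rho.
have u0 : u i0 <= 0 by rewrite subr_le0 -ln_powR ler_ln ?posrE ?powR_gt0.
have u1 : 0 <= u i1 by rewrite subr_ge0 -ln_powR ler_ln ?posrE ?powR_gt0.
(* From [x >= 0] the walk steps by [u i0 <= 0], from [x < 0] by [u i1 >= 0], so it never leaves the
   interval from [u i0] to [u i1]. *)
pose j x := if 0 <= x :> R then i0 else i1.
pose x n := iter n (fun x => x + u (j x)) 0.
have xb n : u i0 <= x n <= u i1.
  elim: n => [|n /andP[l r]] /=; first by rewrite u0.
  by rewrite /j; case: (leP 0 (x n)) => xn; apply/andP; split; lra.
have [z zP] := coded_point (fun n => j (x n)).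
pose s n := [seq j (x i) | i <- iota 0 n].
have sz n : z 0%N = W (s n) (z n).
  elim: n => [//|n IH].
  rewrite IH /s -[in iota 0 n.+1]addn1 iotaD map_cat ifs_word_cat.
  by rewrite [in LHS](zP n).2.
have Ps n : P (s n) = expR (x n) * (rho ^+ n) `^ t.
  elim: n => [|n IH]; first by rewrite /s /= big_nil expR0 expr0 powR1 mul1r.
  rewrite /s -[in iota 0 n.+1]addn1 iotaD map_cat big_cat /=.
  rewrite big_cons big_nil mulr1 add0n.
  rewrite -/(s n) IH exprSr powRM ?(ltW rho0) ?(ltW (rhoX _))// expRD.
  rewrite /u expRD lnK ?posrE// expRN -ln_powR lnK ?posrE ?powR_gt0//.
  by field; rewrite gt_eqF// powR_gt0.
exists (z 0%N); first by case: (zP 0%N).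
exists (expR (u i0)), (expR (u i1)); split; rewrite ?expR_gt0//.
  move=> n; exists (s n), (z n); split; rewrite ?size_map ?size_iota//.
    by case: (zP n).
  by rewrite Ps ler_wpM2r ?powR_ge0// ler_expR; case/andP: (xb n).
move=> n; exists (s n), (z n); split; rewrite ?size_map ?size_iota//.
  by case: (zP n).
by rewrite Ps ler_wpM2r ?powR_ge0// ler_expR; case/andP: (xb n).
Qed.

Lemma coded_bounds (a b : R) z : (forall j, rho `^ b <= p j <= rho `^ a) -> K z ->
  coded_ge b 1 z /\ coded_le a 1 z.
Proof.
move=> ab Kz.
have pw t n : (rho ^+ n) `^ t = (rho `^ t) ^+ n.
  by rewrite -(powR_mulrn n (ltW rho0)) -(powR_mulrn n (powR_ge0 rho t)) powRAC.
split=> n; have [s [z' [sn Kz' zE]]] := attractor_wordP hK n Kz;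
  exists s, z'; split=> //; rewrite mul1r pw -sn.
  by apply: prod_ge => [|j]; [exact: powR_ge0|case/andP: (ab j)].
by apply: prod_le => j; case/andP: (ab j).
Qed.

End regular_points.

(** * Balls on the torus and their lifts *)

Lemma int_range_finite (R : realType) (B : R) :
  exists ms : seq int, forall m : int, `|m%:~R : R| <= B -> m \in ms.
Proof.
pose N := Num.bound B.
exists [seq (i%:Z - N%:Z)%R | i <- iota 0 (N + N).+1] => m mB.
have mN : `|m| <= N%:Z.
  rewrite -(ler_int R) intr_norm; apply: (le_trans mB).
  by apply/ltW/archi_boundP; exact: le_trans mB.
apply/mapP; exists (absz (m + N%:Z)); last by lia.
by rewrite mem_iota; lia.
Qed.

Section torus_measure.
Variables (R : realType) (mu : probability R R).
Local Notation mu_pi := (distribution mu (@torus_pi R)).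

Lemma torus_preimage_ball (x r : R) :
  @torus_pi R @^-1` ball (torus_pi x) r = \bigcup_(m : int) ball (x - m%:~R) r.
Proof.
apply/seteqP; split=> y.
  rewrite /= ballEmdist /= /mdist /=; have [[m ->] _] := torus_distP x y => h.
  exists (- m) => //; rewrite /ball /= intrN opprK.
  by rewrite addrAC.
move=> [m _ h]; rewrite /= ballEmdist /= /mdist /=.
have [_ /(_ (- m))/le_lt_trans] := torus_distP x y; apply.
by move: h; rewrite /ball /= intrN addrAC.
Qed.

Lemma measurable_torus_preimage_ball (x r : R) :
  measurable (@torus_pi R @^-1` ball (torus_pi x) r).
Proof.
rewrite torus_preimage_ball; apply: open_measurable; apply: bigcup_open => m _.
exact: ball_open.
Qed.

Lemma ball_ge_torus x t : ball_ge mu x t -> ball_ge mu_pi (torus_pi x) t.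
Proof.
move=> [c c0 [r1 r10 h]]; exists c => //; exists r1 => // r /h/le_trans; apply.
apply: le_measure; rewrite ?inE.
- exact: measurable_ball.
- exact: measurable_torus_preimage_ball.
- by rewrite torus_preimage_ball => y xy; exists 0; rewrite ?subr0.
Qed.

(** A union bound by induction on [ms]: removing one ball from [A] leaves a set covered by the
    others, hence the arbitrary [A]. *)
Lemma ball_le_cover (K : set R) (ms : seq int) (x t : R) :
  (forall A, measurable A -> A `&` K = set0 -> mu A = 0%E) ->
  (forall m, m \in ms -> ball_le mu (x - m%:~R) t) ->
  exists2 c : R, 0 < c & exists2 r1 : R, 0 < r1 & forall r A, 0 < r < r1 ->
    measurable A ->
    (forall y, A y -> K y -> exists2 m, m \in ms & ball (x - m%:~R) r y) ->
    (mu A <= (c * r `^ t)%:E)%E.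
Proof.
move=> off; elim: ms => [_|m ms IH hms].
  exists 1 => //; exists 1 => // r A _ mA AK.
  rewrite off ?lee_fin ?mul1r ?powR_ge0//.
  by rewrite -subset0 => y [/AK h /h[]].
have [|c1 c10 [r1 r10 h1]] := IH.
  by move=> i ims; apply: hms; rewrite in_cons ims orbT.
have [c2 c20 [r2 r20 h2]] := hms m (mem_head _ _).
exists (c1 + c2); first by rewrite addr_gt0.
exists (Num.min r1 r2); first by rewrite lt_min r10.
move=> r A /andP[r0]; rewrite lt_min => /andP[rr1 rr2] mA AK.
have mB : measurable (ball (x - m%:~R) r) by exact: measurable_ball.
have -> : A = (A `\` ball (x - m%:~R) r) `|` (A `&` ball (x - m%:~R) r).
  by rewrite setUC setUIDK.
apply: (le_trans (measureU2 _ _ _)); [exact: measurableD|exact: measurableI|].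
rewrite mulrDl EFinD; apply: leeD.
  apply: h1; [by rewrite r0|exact: measurableD|].
  move=> y [Ay nB] Ky; have [i + iy] := AK y Ay Ky.
  by rewrite in_cons => /orP[/eqP im|ims]; [rewrite im in iy|exists i].
apply: le_trans (h2 r _); last by rewrite r0.
apply: le_measure; rewrite ?inE//; exact: measurableI.
Qed.

(** For [r < 1] and [x], [y] between 0 and [B], a lifted ball centred at [x - m] can contain [y]
    only if [m] is at most [B + 1] in absolute value. *)
Lemma ball_le_torus (K : set R) (B : R) (ms : seq int) (x t : R) :
  (forall A, measurable A -> A `&` K = set0 -> mu A = 0%E) ->
  (forall y, K y -> 0 <= y <= B) -> K x ->
  (forall m : int, `|m%:~R : R| <= B + 1 -> m \in ms) ->
  (forall m, m \in ms -> ball_le mu (x - m%:~R) t) ->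
  ball_le mu_pi (torus_pi x) t.
Proof.
move=> off KB Kx msB hms.
have [c c0 [r1 r10 h]] := ball_le_cover off hms.
exists c => //; exists (Num.min 1 r1); first by rewrite lt_min ltr01.
move=> r /andP[r0]; rewrite lt_min => /andP[rl1 rr1].
apply: h; [by rewrite r0|exact: measurable_torus_preimage_ball|].
rewrite torus_preimage_ball => y [m _ xy] Ky; exists m => //; apply: msB.
have /andP[x0 xB] := KB _ Kx; have /andP[y0 yB] := KB _ Ky.
move: xy; rewrite /ball /= ltr_norml => /andP[l1 l2].
by rewrite ler_norml; apply/andP; split; lra.
Qed.

End torus_measure.

(** * The interval of local dimensions, on the line and on the torus *)

Theorem theorem3p12 (R : realType) (k : nat) (rho : R) (d p : 'I_k.+1 -> R)
    (K : set R) (mu : probability R R)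
    (hk : (1 <= k)%N) (hrho : 0 < rho < 1)
    (hd0 : d ord0 = 0)
    (hd : forall i j : 'I_k.+1, (i < j)%N -> d i < d j)
    (hdelta : delta rho d \is a Num.int)
    (hp : forall j, 0 < p j) (hp1 : \sum_(j < k.+1) p j = 1)
    (hK : self_similar_set rho d K)
    (hmu : self_similar_measure rho d p mu)
    (hssc : strong_separation rho d K)
    (hft : finite_type_torus rho d) :
  let mu_pi : probability (torus R) R := distribution mu (@torus_pi R) in
  let a := ln (\big[Num.max/p ord0]_(j < k.+1) p j) / ln rho in
  let b := ln (\big[Num.min/p ord0]_(j < k.+1) p j) / ln rho in
  locdims mu K = `[a%:E, b%:E]%classic /\
  `[a%:E, b%:E]%classic = locdims mu_pi (@torus_pi R @` K).
Proof.
move=> mu_pi; set pmax := \big[_/_]_(_ < _) _.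
set pmin := \big[_/_]_(_ < _) _ => a b.
have [rho0 rho1] := andP hrho.
have lrho : ln rho < 0 by rewrite ln_lt0.
have [e e0 gap] := attractor_gap hK hssc.
have off := @mu_off_attractor _ _ _ _ _ _ _ hrho hK hp hp1 hmu.
have [i1 maxE] : exists i, pmax = p i.
  rewrite /pmax; elim/big_ind: _ => [|x y [i ->] [j ->]|i _]; first by exists ord0.
    by rewrite /Num.max; case: ifP => _; [exists j|exists i].
  by exists i.
have [i0 minE] : exists i, pmin = p i.
  rewrite /pmin; elim/big_ind: _ => [|x y [i ->] [j ->]|i _]; first by exists ord0.
    by rewrite /Num.min; case: ifP => _; [exists i|exists j].
  by exists i.
have rho_log q : 0 < q -> rho `^ (ln q / ln rho) = q.
  by move=> q0; rewrite /powR gt_eqF// divfK ?lt_eqF// lnK.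
have ra : rho `^ a = p i1 by rewrite rho_log ?maxE.
have rb : rho `^ b = p i0 by rewrite rho_log ?minE.
have pab j : rho `^ b <= p j <= rho `^ a.
  by rewrite ra rb -maxE -minE bigmin_le le_bigmax.
have pmax1 : pmax <= 1.
  by rewrite maxE -hp1 (bigD1 i1)//= lerDl sumr_ge0// => j _; exact: ltW.
have a0 : 0 <= a by rewrite mulr_le0// ?ln_le0// invr_le0 ltW.
have ab : a <= b.
  rewrite ler_nM2r ?invr_lt0// ler_ln ?posrE ?maxE ?minE//.
  by rewrite -ra; case/andP: (pab i0).
have b0 : 0 <= b by exact: le_trans ab.
have [Ca Ca0 hCa] := mu_ball_le hrho hK hp hp1 hmu e0 gap a0 ltr01.
have [Cb Cb0 hCb] := mu_ball_ge hrho hK hp hp1 hmu e0 gap hd0 hd b0 ltr01.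
have er0 : 0 < e / rho by exact: divr_gt0.
have geb z : K z -> ball_ge mu z b.
  move=> Kz; exists Cb => //; exists (e / rho) => //; apply: hCb => //.
  by case: (coded_bounds hrho hK hp pab Kz).
have lea y : ball_le mu y a.
  apply: (ball_le_nearby hrho hK hp hp1 hmu a0 Ca0 er0) => z r Kz; apply: hCa => //.
  by case: (coded_bounds hrho hK hp pab Kz).
have point (t : R) : a <= t <= b ->
    exists2 z, K z & ball_ge mu z t /\ ball_le mu z t.
  move=> /andP[at_ tb]; have t0 : 0 <= t by exact: le_trans at_.
  have rho01 : 0 < rho <= 1 by rewrite rho0 ltW.
  have rt : p i0 <= rho `^ t <= p i1.
    by rewrite -ra -rb !ger_powR.
  have [z Kz [C1 [C2 [C10 C20 zge zle]]]] := coded_exponent hrho hK hp hd0 hd rt.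
  exists z => //; split.
    have [C C0 h] := mu_ball_ge hrho hK hp hp1 hmu e0 gap hd0 hd t0 C10.
    by exists C => //; exists (e / rho) => //; exact: h.
  have [C C0 h] := mu_ball_le hrho hK hp hp1 hmu e0 gap t0 C20.
  by exists C => //; exists (e / rho) => //; exact: h.
have Kitv := attractor_itv hrho hK hd0 hd.
have [ms msP] := int_range_finite (delta rho d + 1).
have itv_real (l : \bar R) : `[a%:E, b%:E]%classic l ->
    exists2 t, a <= t <= b & l = t%:E.
  rewrite /= in_itv /=; case: l => [t|/andP[_]|/andP[]]//.
  by rewrite !lee_fin => tab; exists t.
split; apply/seteqP; split=> l.
- move=> [z Kz zl]; rewrite /= in_itv /=.
  exact: (locdim_bounds (geb z Kz) (lea z)).1.
- move=> /itv_real[t tab ->]; have [z Kz [zge zle]] := point t tab.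
  by exists z => //; exact: (locdim_bounds zge zle).2.
- move=> /itv_real[t tab ->]; have [z Kz [zge zle]] := point t tab.
  (* The point [z] of exponent [t] is moved into the isolated piece. Each relevant translate is then
     off [K], or equals [W ta z] and inherits the upper bound on masses at [z]. *)
  have [sg sgP] := isolating_word hrho hK hd0 hd hft e0 gap ms.
  have KW : K (ifs_word rho d sg z) by exact: (attractor_word hK).
  exists (torus_pi (ifs_word rho d sg z)); first by exists (ifs_word rho d sg z).
  apply: (locdim_bounds _ _).2 => //.
    by apply: ball_ge_torus; exact: (ball_ge_word hrho hK hp hp1 hmu e0 gap).
  apply: (ball_le_torus off Kitv KW msP) => m /sgP[dis|[ta sta E]].
    by apply: (ball_le_off hrho hK hp hp1 hmu); exact: dis.
  have -> : ifs_word rho d sg z - m%:~R = ifs_word rho d ta z.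
    by rewrite ifs_wordE E [RHS]ifs_wordE sta; ring.
  exact: (ball_le_word hrho hK hp hp1 hmu e0 gap).
- move=> [_ [z Kz <-] zl]; rewrite /= in_itv /=.
  apply: (locdim_bounds (ball_ge_torus (geb z Kz)) _).1 zl.
  by apply: (ball_le_torus off Kitv Kz msP) => m _.
Qed.
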